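(* Let $(M,d)$ be the countable metric space defined in the context. Let $X$ be an Asplund Banach space and assume that $(M,d)$ embeds bi-Lipschitz into $X$ with distortion $D$. Then $D\ge 2$. Consequently, there is no Asplund Banach space $X$ such that every separable metric space embeds bi-Lipschitz into $X$ with distortion strictly less than $2$.
   Context: $\mathbb N=\{1,2,3,\dots\}$. The metric space $(M,d)$: let $F=\{A\subset\mathbb N: 1\le |A|<\infty\}$ be the set of all finite nonempty subsets of $\mathbb N$, and let $M=\{\emptyset\}\cup\mathbb N\cup F$ (the three pieces are regarded as pairwise disjoint). Make $M$ into a graph by putting an edge between $\emptyset$ and every $n\in\mathbb N$, and an edge between $n\in\mathbb N$ and $A\in F$ exactly when $n\in A$; there are no other edges. The metric $d$ is the shortest path metric of this graph. Explicitly, for $n\ne m$ in $\mathbb N$ and $A\neq B$ in $F$: $d(\emptyset,n)=1$; $d(n,m)=2$; $d(n,A)=1$ if $n\in A$ and $d(n,A)=3$ if $n\notin A$; $d(\emptyset,A)=2$; $d(A,B)=2$ if $A\cap B\ne\emptyset$ and $d(A,B)=4$ if $A\cap B=\emptyset$. A map $f:(M,d)\to(N,\rho)$ between metric spaces is bi-Lipschitz if there are constants $C_1,C_2>0$ with $C_1d(x,y)\le\rho(f(x),f(y))\le C_2d(x,y)$ for all $x,y\in M$; its distortion $\mathrm{dist}(f)$ is the infimum of $C_2/C_1$ over all such pairs of constants. $M$ embeds bi-Lipschitz into $N$ with distortion $D$ if there is a bi-Lipschitz $f:M\to N$ with $\mathrm{dist}(f)=D$. A Banach space $X$ is Asplund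 if every closed separable subspace $Y\subset X$ has separable dual. *)

(* Defs.v *)
(* All Banach spaces are real: the scalars are an arbitrary [R : realType], and
   a Banach space is a [completeNormedModType R]. *)
From HB Require Import structures.
From mathcomp Require Import all_boot all_order all_algebra.
From mathcomp Require Import finmap.
From mathcomp Require Import all_classical all_reals all_analysis.
Import Order.TTheory GRing.Theory Num.Theory.
Import numFieldNormedType.Exports.

Set Implicit Arguments.
Unset Strict Implicit.
Unset Printing Implicit Defensive.

Local Open Scope classical_set_scope.
Local Open Scope ring_scope.

Definition posnat : Type := {n : nat | (0 < n)%N}.
HB.instance Definition _ := SubCountable.on posnat.

Definition nefset : Type := {A : {fset posnat} | A != fset0}.
HB.instance Definition _ := SubCountable.on nefset.

Inductive vertex : Type :=
  | VEmpty
  | VNat of posnat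
  | VFin of nefset.

Definition vertex_code (x : vertex) : unit + (posnat + nefset) :=
  match x with
  | VEmpty => inl tt
  | VNat n => inr (inl n)
  | VFin A => inr (inr A)
  end.

Definition vertex_decode (c : unit + (posnat + nefset)) : vertex :=
  match c with
  | inl _ => VEmpty
  | inr (inl n) => VNat n
  | inr (inr A) => VFin A
  end.

Lemma vertex_codeK : cancel vertex_code vertex_decode.
Proof. by case. Qed.

HB.instance Definition _ := Countable.copy vertex (can_type vertex_codeK).

Definition edge (x y : vertex) : bool :=
  match x, y with
  | VEmpty, VNat _ | VNat _, VEmpty => true
  | VNat n, VFin A | VFin A, VNat n => n \in val A
  | _, _ => false
  end.

Definition walk (x y : vertex) (k : nat) : Prop :=
  exists p : seq vertex, [/\ path edge x p, last x p = y & size p = k].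

Definition explicit_dist (x y : vertex) : nat :=
  (match x, y with
  | VEmpty, VEmpty => 0
  | VEmpty, VNat _ | VNat _, VEmpty => 1
  | VEmpty, VFin _ | VFin _, VEmpty => 2
  | VNat n, VNat m => if n == m then 0 else 2
  | VNat n, VFin A | VFin A, VNat n => if n \in val A then 1 else 3
  | VFin A, VFin B =>
      if A == B then 0 else if (val A `&` val B)%fset != fset0 then 2 else 4
  end)%N.

Lemma edge_sym x y : edge x y = edge y x.
Proof. by case: x y => [|n|A] [|m|B]. Qed.

Lemma explicit_dist_edge x y z :
  edge x z -> (explicit_dist x y <= (explicit_dist z y).+1)%N.
Proof.
case: x y z => [|n|A] [|m|B] [|k|C] //=; do ?by [case: ifP].
all: try by move=> _; case: ifP.
- by move=> nC; case: eqP => [<-|_]; [rewrite nC|case: ifP].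
- move=> nC; case: ifP => // nB; case: eqP => [CB|_]; last by case: ifP.
  by rewrite -CB nC in nB.
- by move=> kA; case: ifP => // mA; case: eqP => // km; rewrite -km kA in mA.
- move=> kA; case: eqP => // _; case: ifP => [_|/negbFE/eqP AB0].
    by case: ifP.
  case: ifP => // kB.
  have : k \in (val A `&` val B)%fset by rewrite inE kA.
  by rewrite AB0 inE.
Qed.

Lemma explicit_dist_walk_le x y k : walk x y k -> (explicit_dist x y <= k)%N.
Proof.
case=> p [+ + <-] {k}; elim: p x => [|z p IHp] x /=.
  by move=> _ <-; case: x => //= n; rewrite eqxx.
move=> /andP[xz zp] lp.
by rewrite (leq_trans (explicit_dist_edge y xz))// ltnS IHp.
Qed.

Lemma walk_cat x y z k l : walk x y k -> walk y z l -> walk x z (k + l).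
Proof.
move=> [p [xp lp <-]] [q [yq lq <-]]; exists (p ++ q).
by rewrite cat_path last_cat size_cat lp xp.
Qed.

Lemma walk_edge x y : edge x y -> walk x y 1.
Proof. by move=> xy; exists [:: y]; rewrite /= xy. Qed.

Lemma walk_sym x y k : walk x y k -> walk y x k.
Proof.
move=> [p [xp lp <-]]; exists (rev (belast x p)); split.
- rewrite -lp rev_path; apply: sub_path xp => u v /=; by rewrite edge_sym.
- by case: p lp {xp} => //= z p _; rewrite rev_cons last_rcons.
- by rewrite size_rev size_belast.
Qed.

Lemma walk_explicit_dist x y : walk x y (explicit_dist x y).
Proof.
have w0 u : walk u u 0 by exists [::].
have wE n : walk VEmpty (VNat n) 1 by exact: walk_edge.
have wN n : walk (VNat n) VEmpty 1 by exact: walk_edge.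
have wF n A : n \in val A -> walk (VNat n) (VFin A) 1.
  by move=> nA; exact: walk_edge.
have neF (A : nefset) : exists n, n \in val A by exact/fset0Pn/(valP A).
have wEF A : walk VEmpty (VFin A) 2.
  by have [n nA] := neF A; exact: (walk_cat (wE n) (wF _ _ nA)).
have wNN n m : walk (VNat n) (VNat m) 2 by exact: (walk_cat (wN n) (wE m)).
have wNF n A : walk (VNat n) (VFin A) (if n \in val A then 1 else 3).
  case: ifPn => [/wF//|_]; exact: (walk_cat (wN n) (wEF A)).
case: x y => [|n|A] [|m|B] //=.
- by case: eqP => [->|].
- exact/walk_sym.
- exact/walk_sym.
- case: eqP => [->//|_]; case: ifPn => [/fset0Pn[n]|_].
    rewrite inE => /andP[nA nB]; exact: (walk_cat (walk_sym (wF _ _ nA)) (wF _ _ nB)).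
  exact: (walk_cat (walk_sym (wEF A)) (wEF B)).
Qed.

Lemma walk_exists x y : exists k, `[< walk x y k >].
Proof. by exists (explicit_dist x y); apply/asboolP/walk_explicit_dist. Qed.

Definition path_dist (x y : vertex) : nat := ex_minn (walk_exists x y).

Lemma path_distE x y : path_dist x y = explicit_dist x y.
Proof.
rewrite /path_dist; case: ex_minnP => k /asboolP xyk kmin; apply/eqP.
rewrite eqn_leq explicit_dist_walk_le// andbT.
exact/kmin/asboolP/walk_explicit_dist.
Qed.

Lemma path_dist_walk_le x y k : walk x y k -> (path_dist x y <= k)%N.
Proof. by rewrite path_distE; exact: explicit_dist_walk_le. Qed.

Lemma walk_path_dist x y : walk x y (path_dist x y).
Proof. by rewrite path_distE; exact: walk_explicit_dist. Qed.

(* The parameter [R] only records where the metric takes its values. *)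
Definition graph_space (R : realType) : Type := vertex.

Section graph_space_metric.
Variable R : realType.

HB.instance Definition _ := Countable.on (graph_space R).

Let dist (x y : graph_space R) : R := (path_dist x y)%:R.

Let distxx x : dist x x = 0.
Proof.
apply/eqP; rewrite pnatr_eq0 -leqn0; apply: path_dist_walk_le.
by exists [::].
Qed.

Let dist_positivity x y : dist x y = 0 -> x = y.
Proof.
move=> /eqP; rewrite pnatr_eq0 => /eqP d0.
by have := walk_path_dist x y; rewrite d0 => -[[|? ?] [_ ? ?]].
Qed.

Let dist_sym x y : dist x y = dist y x.
Proof.
congr _%:R; apply/eqP; rewrite eqn_leq.
by rewrite !path_dist_walk_le//; exact/walk_sym/walk_path_dist.
Qed.

Let dist_triangle y x z : dist x z <= dist x y + dist y z.
Proof.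
rewrite -natrD ler_nat; apply: path_dist_walk_le.
exact: walk_cat (walk_path_dist _ _) (walk_path_dist _ _).
Qed.

HB.instance Definition _ := isMetric.Build R (graph_space R)
  distxx dist_positivity dist_sym dist_triangle.

End graph_space_metric.

Lemma mdist_graph_space (R : realType) (x y : graph_space R) :
  mdist x y = (path_dist x y)%:R.
Proof. by []. Qed.

Section bilipschitz.
Context {R : realType} {M : metricType R} {X : normedModType R}.
Implicit Types f : M -> X.

Definition bilipschitz_bounds f (C1 C2 : R) : Prop :=
  [/\ 0 < C1, 0 < C2 &
    forall x y, C1 * mdist x y <= `|f x - f y| <= C2 * mdist x y].

Definition bilipschitz f : Prop := exists C1 C2, bilipschitz_bounds f C1 C2.

(* [inf] is total, with junk value on empty sets: only meaningful when [f] is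
   bi-Lipschitz. *)
Definition distortion f : R :=
  inf [set r | exists C1 C2, bilipschitz_bounds f C1 C2 /\ r = C2 / C1].

End bilipschitz.

Definition embeds_with_distortion {R : realType} (M : metricType R)
    (X : normedModType R) (D : R) : Prop :=
  exists f : M -> X, bilipschitz f /\ distortion f = D.

Definition separable (T : topologicalType) : Prop :=
  exists A : set T, countable A /\ dense A.

Section subspace.
Context {R : realType} {X : normedModType R} (Y : submodClosed X).

Record normed_subspace : Type :=
  NormedSubspace { subspace_val :> X; subspace_valP : subspace_val \in Y }.

HB.instance Definition _ := [isSub for subspace_val].
HB.instance Definition _ := [Choice of normed_subspace by <:].
HB.instance Definition _ :=
  [SubChoice_isSubLmodule of normed_subspace by <:].

Let norm (y : normed_subspace) : R := `|subspace_val y|.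

Let ler_normD x y : norm (x + y) <= norm x + norm y.
Proof. exact: ler_normD. Qed.

Let normrZ (l : R) x : norm (l *: x) = `|l| * norm x.
Proof. exact: normrZ. Qed.

Let normr0_eq0 x : norm x = 0 -> x = 0.
Proof. by move=> /normr0_eq0 x0; exact: val_inj. Qed.

HB.instance Definition _ :=
  Lmodule_isNormed.Build R normed_subspace ler_normD normrZ normr0_eq0.

End subspace.

Section dual.
Context {R : realType} (V : normedModType R).

Definition functional : {pred V -> R^o} :=
  fun f => `[< linear f /\ continuous f >].

Lemma functional_submod_closed : GRing.submod_closed functional.
Proof.
split.
  apply/asboolP; split; last exact: cst_continuous.
  by move=> a x y; rewrite /= scaler0 addr0.
move=> a f g /asboolP[lf cf] /asboolP[lg cg]; apply/asboolP; split.
  move=> b x y; rewrite !fctE lf lg !scalerDr !scalerA (mulrC a b).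
  by rewrite addrACA.
move=> x; apply: (@continuousD _ _ _ (a *: f) g); last exact: cg.
by apply: continuousZr; exact: cf.
Qed.

HB.instance Definition _ := GRing.isSubmodClosed.Build R (V -> R^o) functional
  functional_submod_closed.

Record dual : Type :=
  Dual { dual_val :> V -> R^o; dual_valP : dual_val \in functional }.

HB.instance Definition _ := [isSub for dual_val].
HB.instance Definition _ := [Choice of dual by <:].
HB.instance Definition _ := [SubChoice_isSubLmodule of dual by <:].

Definition dual_norm (f : dual) : R :=
  sup [set `|f x| | x in [set x : V | `|x| <= 1]].

Lemma dual_linear (f : dual) : linear f.
Proof. by have /asboolP[] := dual_valP f. Qed.

Lemma dual_continuous (f : dual) : continuous f.
Proof. by have /asboolP[] := dual_valP f. Qed.

Lemma dual_scale (f : dual) (a : R) (x : V) : f (a *: x) = a * f x.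
Proof.
have f0 : f 0 = 0.
  by have := dual_linear f (-1) 0 0; rewrite scaler0 addr0 scaleN1r addNr.
by have := dual_linear f a x 0; rewrite !addr0 f0 addr0.
Qed.

Let has_sup_dual (f : dual) :
  has_sup [set `|f x| | x in [set x : V | `|x| <= 1]].
Proof.
split; first by exists `|f 0|, 0 => //=; rewrite normr0 ler01.
pose fL := GRing.isLinear.Build R V R^o *:%R f (dual_linear f).
pose g : {linear V -> R^o} := HB.pack (dual_val f) fL.
have /bounded_funP/(_ 1)[M gM] : bounded_near g (nbhs (0 : V)).
  by apply/linear_bounded_continuous; exact: dual_continuous.
by exists M => _ [x /= x1 <-]; exact: gM.
Qed.

Let le_dual_norm1 (f : dual) (x : V) : `|x| <= 1 -> `|f x| <= dual_norm f.
Proof. by move=> x1; apply: ub_le_sup; [exact: (has_sup_dual f).2|exists x]. Qed.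

Let dual_norm_ge0 (f : dual) : 0 <= dual_norm f.
Proof.
by apply: (le_trans (normr_ge0 (f 0))); apply: le_dual_norm1; rewrite normr0.
Qed.

Lemma le_dual_norm (f : dual) (x : V) : `|f x| <= dual_norm f * `|x|.
Proof.
have [->|x0] := eqVneq x 0.
  by have := dual_scale f 0 0; rewrite scale0r mul0r => ->; rewrite !normr0 mulr0.
have nx0 : 0 < `|x| by rewrite normr_gt0.
rewrite -ler_pdivrMr//; have := @le_dual_norm1 f (`|x|^-1 *: x).
rewrite dual_scale normrZ normrM normfV normr_id mulVf ?gt_eqF//.
by rewrite mulrC; exact.
Qed.

Let dual_norm_le (f : dual) (M : R) :
  (forall x : V, `|x| <= 1 -> `|f x| <= M) -> dual_norm f <= M.
Proof.
move=> fM; apply: ge_sup; first exact: (has_sup_dual f).1.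
by move=> _ [x /= x1 <-]; exact: fM.
Qed.

Let ler_dual_normD (f g : dual) :
  dual_norm (f + g) <= dual_norm f + dual_norm g.
Proof.
apply: dual_norm_le => x x1; rewrite (le_trans (ler_normD _ _))//.
by rewrite lerD// le_dual_norm1.
Qed.

Let dual_normZ (a : R) (f : dual) : dual_norm (a *: f) = `|a| * dual_norm f.
Proof.
have nZ (b : R) (g : dual) : dual_norm (b *: g) <= `|b| * dual_norm g.
  apply: dual_norm_le => x x1; rewrite [leLHS]normrM.
  by rewrite ler_wpM2l// le_dual_norm1.
have [->|a0] := eqVneq a 0.
  apply/le_anti; rewrite (le_trans (nZ _ _))//=.
  by rewrite normr0 mul0r dual_norm_ge0.
apply/le_anti; rewrite nZ/= -ler_pdivlMl ?normr_gt0// -normfV.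
by rewrite (le_trans _ (nZ _ _))// scalerA mulVf// scale1r.
Qed.

Let dual_norm0_eq0 (f : dual) : dual_norm f = 0 -> f = 0.
Proof.
move=> f0; apply/val_inj/funext => x /=; apply/eqP; rewrite -normr_le0.
by rewrite (le_trans (le_dual_norm f x))// f0 mul0r.
Qed.

HB.instance Definition _ :=
  Lmodule_isNormed.Build R dual ler_dual_normD dual_normZ dual_norm0_eq0.

End dual.

Definition asplund {R : realType} (X : completeNormedModType R) : Prop :=
  forall Y : submodClosed X, closed [set x : X | x \in Y] ->
    separable (normed_subspace Y) -> separable (dual (normed_subspace Y)).

(* Main.v *)
(* If f satisfies C1 d <= |f x - f y| <= C2 d with C2 < 2 C1, let P and N be
   disjoint finite sets, n in P and m in N. Since d(P, N) = 4 while
   d(P, n) = d(N, m) = 1, the vector f n - f m is 2 C2-close to f P - f N, whose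
   norm is at least 4 C1. Letting P and N increase to an infinite set S and its
   complement, Hahn-Banach gives a functional g_S of norm at most 1 with
   g_S (f n - f m) >= 4 C1 - 2 C2 > 0 for all n in S and m outside S. Running
   over 2^N pairwise incomparable sets S, this produces an uncountable separated
   family in the dual of the closed span of the f n, which is separable. *)
From HB Require Import structures.
Require Import Defs.
From mathcomp Require Import all_boot all_order all_algebra.
From mathcomp Require Import finmap lra.
From mathcomp Require Import all_classical all_reals all_analysis.
Import Order.TTheory GRing.Theory Num.Theory.
Import numFieldNormedType.Exports.

Local Open Scope ring_scope.
Local Open Scope classical_set_scope.

(** * Sublinear functionals and Hahn-Banach by minimality *)

Section sublinear.
Context {R : realType} {V : lmodType R}.
Implicit Types (p q : V -> R) (K : set (V * R)).

Definition sublinear q : Prop :=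
  (forall x y, q (x + y) <= q x + q y) /\
  (forall t x, 0 < t -> q (t *: x) <= t * q x).

Definition convex_cone K : Prop :=
  [/\ K (0, 0), forall a b, K a -> K b -> K (a.1 + b.1, a.2 + b.2) &
      forall t a, 0 < t -> K a -> K (t *: a.1, t * a.2)].

Lemma sublinear0 q : sublinear q -> q 0 = 0.
Proof.
move=> [_ qZ]; have := qZ 2^-1 0 ltac:(lra); have := qZ 2 0 ltac:(lra).
rewrite !scaler0; lra.
Qed.

Lemma sublinear_opp_le q x : sublinear q -> - q (- x) <= q x.
Proof.
by move=> sq; have := sq.1 x (- x); rewrite subrr sublinear0//; lra.
Qed.

(** Near-minimizers at x and at y are combined into one index that works at x + y; the bound [l]
    keeps every infimum finite. Serves both the infimum over a cone and the infimum of a chain. *)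
Lemma sublinear_inf (I : Type) (D : set I) (F : I -> V -> R) (l : V -> R) :
  D !=set0 -> (forall i x, D i -> l x <= F i x) ->
  (forall i j x y, D i -> D j ->
     exists2 k, D k & F k (x + y) <= F i x + F j y) ->
  (forall i t x, D i -> 0 < t -> exists2 k, D k & F k (t *: x) <= t * F i x) ->
  sublinear (fun x => inf [set F i x | i in D]).
Proof.
move=> [i0 Di0] lF FD FZ.
have infP x i : D i -> inf [set F i x | i in D] <= F i x.
  move=> Di; apply: ge_inf; last by exists i.
  by exists (l x) => _ [j Dj <-]; exact: lF.
have lt_infP x r : inf [set F i x | i in D] < r -> exists2 i, D i & F i x < r.
  by move=> /inf_lt[|_ [i Di <-] ?]; [exists (F i0 x), i0|exists i].
split=> [x y|t x t0].
- apply/ler_addgt0Pr => e e0.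
  have [i Di ix] := lt_infP x (inf [set F i x | i in D] + e / 2) ltac:(lra).
  have [j Dj jy] := lt_infP y (inf [set F i y | i in D] + e / 2) ltac:(lra).
  have [k Dk kxy] := FD i j x y Di Dj.
  by have := infP (x + y) k Dk; lra.
- rewrite -ler_pdivrMl//; apply: lb_le_inf; first by exists (F i0 x), i0.
  move=> _ [i Di <-]; rewrite ler_pdivrMl//.
  by have [k Dk] := FZ i t x Di t0; apply: le_trans; exact: infP.
Qed.

(** When q is sublinear and K is a convex cone with a.2 <= q a.1 on K, a linear g below this
    functional satisfies g <= q and also a.2 <= g a.1 on K, as evaluation at - a.1 shows. Lower
    bounds on g are thus encoded in its majorant. *)
Definition cone_inf q K : V -> R :=
  fun x => inf [set q (x + a.1) - a.2 | a in K].

Section cone_inf.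
Variables (q : V -> R) (K : set (V * R)).
Hypotheses (sq : sublinear q) (cK : convex_cone K).
Hypothesis Kq : forall a, K a -> a.2 <= q a.1.

Let cone_inf_lb x a : K a -> - q (- x) <= q (x + a.1) - a.2.
Proof.
move=> Ka; have := sq.1 (x + a.1) (- x); have := Kq a Ka.
by rewrite addrAC subrr add0r; lra.
Qed.

Lemma cone_inf_le x a : K a -> cone_inf q K x <= q (x + a.1) - a.2.
Proof.
move=> Ka; apply: ge_inf; last by exists a.
by exists (- q (- x)) => _ [b Kb <-]; exact: cone_inf_lb.
Qed.

Lemma cone_inf_sublinear : sublinear (cone_inf q K).
Proof.
have [K0 KD KZ] := cK.
apply: (@sublinear_inf _ _ (fun a x => q (x + a.1) - a.2) (fun x => - q (- x))).
- by exists (0, 0).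
- by move=> a x; exact: cone_inf_lb.
- move=> a b x y Ka Kb; exists (a.1 + b.1, a.2 + b.2); first exact: KD.
  by have := sq.1 (x + a.1) (y + b.1); rewrite /= addrACA; lra.
- move=> a t x Ka t0; exists (t *: a.1, t * a.2); first exact: KZ.
  by have := sq.2 t (x + a.1) t0; rewrite /= scalerDr; lra.
Qed.

End cone_inf.

(** Zorn's lemma for the reversed pointwise order: the infimum of a chain is finite because every
    sublinear r <= p satisfies - p (- x) <= r x. *)
Lemma sublinear_minimal p : sublinear p ->
  exists q, [/\ sublinear q, forall x, q x <= p x &
    forall q', sublinear q' -> (forall x, q' x <= q x) -> q' = q].
Proof.
move=> sp; pose P q := sublinear q /\ forall x, q x <= p x; pose T := {q | P q}.
pose below (q q' : T) := `[< forall x, sval q' x <= sval q x >].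
have [||||[q [sq qp]] qmin] := @Zorn T below.
- by move=> q; apply/asboolP.
- move=> q1 q2 q3 /asboolP q12 /asboolP q23; apply/asboolP => x.
  exact: le_trans (q23 x) (q12 x).
- move=> [q1 ?] [q2 ?] /asboolP/= q12 /asboolP/= q21.
  apply: eq_exist; apply/funext => x.
  by apply/le_anti; rewrite q12 q21.
- move=> A totA; have [[q0 Aq0]|A0] := pselect (A !=set0); last first.
    (* The empty chain is bounded by p itself. *)
    exists (exist P p (conj sp (fun=> lexx _))) => r Ar.
    by case: A0; exists r.
  have lbA (r : T) x : - p (- x) <= sval r x.
    apply: le_trans (sublinear_opp_le _ x (proj1 (svalP r))).
    by rewrite lerN2 (svalP r).2.
  have le_infA r x : A r -> inf [set sval r x | r in A] <= sval r x.
    move=> Ar; apply: ge_inf; last by exists r.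
    by exists (- p (- x)) => _ [r' _ <-].
  suff sA : sublinear (fun x => inf [set sval r x | r in A]).
    have inf_le_p x : inf [set sval r x | r in A] <= p x.
      exact: le_trans (le_infA q0 x Aq0) ((svalP q0).2 x).
    by exists (exist P _ (conj sA inf_le_p)) => r Ar; apply/asboolP => x;
      exact: le_infA.
  apply: (@sublinear_inf _ _ (fun r : T => sval r) (fun x => - p (- x))).
  + by exists q0.
  + by move=> r x _.
  + move=> r1 r2 x y Ar1 Ar2.
    have [/asboolP r12|/asboolP r21] := totA _ _ Ar1 Ar2.
      exists r2 => //; apply: le_trans ((svalP r2).1.1 x y) _.
      by rewrite lerD2r.
    exists r1 => //; apply: le_trans ((svalP r1).1.1 x y) _.
    by rewrite lerD2l.
  + by move=> r t x Ar t0; exists r => //; exact: (svalP r).1.2.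
exists q; split => // q' sq' q'q.
have q'p x : q' x <= p x by exact: le_trans (q'q x) (qp x).
have := qmin (exist P q' (conj sq' q'p)) ltac:(exact/asboolP).
by move=> /(congr1 sval).
Qed.

(* Replacing q by its infimum along the ray spanned by (y, q y) gives a
   sublinear functional below q, hence q itself when q is minimal. *)
Lemma sublinear_minimal_linear q : sublinear q ->
  (forall q', sublinear q' -> (forall x, q' x <= q x) -> q' = q) ->
  linear (q : V -> R^o).
Proof.
move=> sq qmin.
have qZ_ge0 t x : 0 <= t -> q (t *: x) = t * q x.
  rewrite le_eqVlt => /predU1P[<-|t0].
    by rewrite scale0r mul0r sublinear0.
  apply/le_anti; rewrite sq.2//= -ler_pdivlMl//.
  have := sq.2 t^-1 (t *: x) ltac:(by rewrite invr_gt0).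
  by rewrite scalerA mulVf ?gt_eqF// scale1r.
have qD x y : q (x + y) = q x + q y.
  apply/le_anti; rewrite sq.1/=.
  pose K := [set a : V * R | exists2 t, 0 <= t & a = (t *: y, t * q y)].
  have K0 : K (0, 0) by exists 0; rewrite ?scale0r ?mul0r.
  have cK : convex_cone K.
    split=> //.
      move=> _ _ [t t0 ->] [s s0 ->]; exists (t + s); first lra.
      by rewrite /= scalerDl mulrDl.
    move=> s _ s0 [t t0 ->]; exists (s * t); first by rewrite mulr_ge0// ltW.
    by rewrite /= scalerA mulrA.
  have Kq a : K a -> a.2 <= q a.1.
    by move=> [t t0 ->] /=; rewrite qZ_ge0.
  have qK : cone_inf q K = q.
    apply: qmin; first exact: cone_inf_sublinear.
    by move=> z; have := cone_inf_le _ _ sq Kq z _ K0; rewrite /= addr0 subr0.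
  have Ky : K (y, q y) by exists 1; rewrite ?scale1r ?mul1r.
  by have := cone_inf_le _ _ sq Kq x _ Ky; rewrite qK /=; lra.
have qN x : q (- x) = - q x.
  by have := qD x (- x); rewrite subrr sublinear0//; lra.
move=> t x y; rewrite qD; congr (_ + _).
have [t0|t0] := leP 0 t; first exact: qZ_ge0.
rewrite -[t]opprK scaleNr qN qZ_ge0 ?oppr_ge0 ?ltW//.
by rewrite -mulNr.
Qed.

Lemma hahn_banach p : sublinear p ->
  exists g : V -> R^o, linear g /\ forall x, g x <= p x.
Proof.
move=> /sublinear_minimal[q [sq qp qmin]].
by exists q; split => //; exact: sublinear_minimal_linear.
Qed.

End sublinear.

(** * A limit functional in a normed space *)

Section normed.
Context {R : realType}.

(* Hahn-Banach for the cone generated by the pairs (u, a - b), where u is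
   eventually b-close to v; it plays the role of a weak* limit of functionals
   norming the v k. *)
Lemma eventually_close_functional (X : normedModType R) (v : nat -> X)
    (a b : R) :
  (forall k, a <= `|v k|) ->
  exists g : X -> R^o, [/\ linear g, forall x, `|g x| <= `|x| &
    forall u N, (forall k, (N <= k)%N -> `|u - v k| <= b) -> a - b <= g u].
Proof.
move=> av.
pose K := [set c : X * R | exists t N, [/\ 0 <= t, c.2 = t * (a - b) &
  forall k, (N <= k)%N -> `|c.1 - t *: v k| <= t * b]].
have snorm : sublinear (fun x : X => `|x|).
  split=> [|t x t0]; first exact: ler_normD.
  by rewrite normrZ gtr0_norm.
have cK : convex_cone K.
  split.
  - exists 0, 0%N; split=> [//||k _]; rewrite /= mul0r//.
    by rewrite scale0r subr0 normr0.
  - move=> c d [t [N [t0 ct cv]]] [s [M [s0 ds dv]]].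
    exists (t + s), (maxn N M); split=> /= [||k]; first lra.
      by rewrite ct ds mulrDl.
    rewrite geq_max => /andP[/cv ck /dv dk].
    rewrite scalerDl opprD addrACA (le_trans (ler_normD _ _))//; lra.
  - move=> r c r0 [t [N [t0 ct cv]]]; exists (r * t), N.
    split=> /= [||k /cv ck].
    + by rewrite mulr_ge0// ltW.
    + by rewrite ct mulrA.
    + by rewrite -scalerA -scalerBr normrZ gtr0_norm// -mulrA ler_wpM2l// ltW.
(* Triangle inequality at k = N: the norm of c.1 is at least t * a - t * b. *)
have Knorm c : K c -> c.2 <= `|c.1|.
  move=> [t [N [t0 -> cv]]]; have := cv N (leqnn _).
  have : t * a <= `|t *: v N| by rewrite normrZ ger0_norm// ler_wpM2l.
  have := ler_normB c.1 (c.1 - t *: v N); rewrite opprB addrC subrK; lra.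
have [g [lg gK]] := hahn_banach _ (cone_inf_sublinear _ _ snorm cK Knorm).
have g_lt c : K c -> forall x, g x <= `|x + c.1| - c.2.
  by move=> Kc x; apply: le_trans (gK x) _; exact: cone_inf_le Kc.
have g_le x : g x <= `|x|.
  have [K0 _ _] := cK.
  by have := g_lt _ K0 x; rewrite /= addr0 subr0.
have g0 : g 0 = 0.
  by have := lg (-1) 0 0; rewrite scaler0 addr0 scaleN1r addNr.
have gN x : g (- x) = - g x.
  by have := lg (-1) x 0; rewrite !scaleN1r g0 !addr0.
exists g; split=> // [x|u N uv].
  by rewrite ler_norml g_le andbT lerNl -gN -[leRHS]normrN g_le.
have Ku : K (u, a - b).
  by exists 1, N; split=> [||k /uv]; rewrite ?mul1r ?scale1r.
(* At x = - u the majorant equals - (a - b). *)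
by have := g_lt _ Ku (- u); rewrite /= addNr normr0 gN; lra.
Qed.

(** * Density, separable subspaces and non-separability *)

Lemma closure_norm (X : normedModType R) (A : set X) x :
  closure A x <-> forall e : R, 0 < e -> exists2 y, A y & `|x - y| < e.
Proof.
split=> [Ax e e0|Ax B /nbhs_ballP[e /= e0 eB]].
  by have [y [Ay]] := Ax _ (nbhsx_ballx x e e0); rewrite -ball_normE; exists y.
by have [y Ay xy] := Ax e e0; exists y; split=> //; apply: eB;
  rewrite -ball_normE.
Qed.

Lemma dense_norm (X : normedModType R) (A : set X) :
  (forall x (e : R), 0 < e -> exists2 y, A y & `|x - y| < e) <-> dense A.
Proof.
split=> [Ax O [x Ox] oO|dA x e e0].
  have /closure_norm clx := Ax x.
  have [y [Ay Oy]] := clx O (open_nbhs_nbhs (conj oO Ox)).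
  by exists y.
have [|y [xy Ay]] := dA (ball x e) _ (ball_open x e).
  by exists x; exact: ballxx.
by move: xy; rewrite -ball_normE; exists y.
Qed.

Lemma separable_closed_subspace (X : normedModType R) (u : nat -> X) :
  exists Y : submodClosed X, [/\ forall n, u n \in Y,
    closed [set x : X | x \in Y] & separable (normed_subspace Y)].
Proof.
(* Finite rational combinations of the [u n], coded by a countable type; Y is the closure of their
   set. *)
pose q (c : seq (rat * nat)) : X := \sum_(i <- c) ratr i.1 *: u i.2.
pose S : {pred X} := fun x => `[< closure (range q) x >].
have qD c d : q c + q d = q (c ++ d) by rewrite /q big_cat.
have qZ r c : ratr r *: q c = q [seq (r * i.1, i.2) | i <- c].
  rewrite /q big_map scaler_sumr; apply: eq_bigr => i _ /=.
  by rewrite scalerA rmorphM.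
have q_closure c : closure (range q) (q c) by apply: subset_closure; exists c.
have S_submod : GRing.submod_closed S.
  split; first by apply/asboolP; have := q_closure [::]; rewrite /q big_nil.
  move=> a x y /asboolP/closure_norm xS /asboolP/closure_norm yS.
  apply/asboolP/closure_norm => e e0.
  (* The error splits into three parts of at most e / 3. The rational r is chosen after c, since its
     distance to a must compensate for the norm of q c; adding 1 keeps the denominators positive. *)
  have a0 : 0 < `|a| + 1 by rewrite ltr_wpDl.
  have [_ [c _ <-] xc] := xS (e / 3 / (`|a| + 1)) ltac:(by rewrite !divr_gt0).
  have [_ [d _ <-] yd] := yS (e / 3) ltac:(lra).
  have c0 : 0 < `|q c| + 1 by rewrite ltr_wpDl.
  have r0 : 0 < e / 3 / (`|q c| + 1) by rewrite !divr_gt0.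
  have [r /[!in_itv]/= /andP[ar ra]] :=
    @rat_in_itvoo R a (a + e / 3 / (`|q c| + 1)) ltac:(by rewrite ltrDl).
  exists (ratr r *: q c + q d).
    by rewrite qZ qD; exists ([seq (r * i.1, i.2) | i <- c] ++ d).
  have -> : a *: x + y - (ratr r *: q c + q d) =
      a *: (x - q c) + (a - ratr r) *: q c + (y - q d).
    rewrite scalerBr scalerBl opprD addrACA; congr (_ + _).
    by rewrite addrA subrK.
  have ax : `|a *: (x - q c)| <= e / 3.
    rewrite normrZ; have : (`|a| + 1) * `|x - q c| < e / 3.
      by rewrite mulrC -ltr_pdivlMr.
    by have := normr_ge0 (x - q c); lra.
  have ac : `|(a - ratr r) *: q c| <= e / 3.
    rewrite normrZ.
    have : `|a - ratr r| * (`|q c| + 1) < e / 3.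
      by rewrite -ltr_pdivlMr// ltr_norml; lra.
    by have := normr_ge0 (a - ratr r); lra.
  have := ler_normD (a *: (x - q c) + (a - ratr r) *: q c) (y - q d).
  have := ler_normD (a *: (x - q c)) ((a - ratr r) *: q c); lra.
pose SY := GRing.isSubmodClosed.Build R X S S_submod.
pose Y : submodClosed X := HB.pack S SY.
exists Y; split.
- move=> n; apply/asboolP; have := q_closure [:: (1, n)].
  by rewrite /q big_seq1/= rmorph1 scale1r.
- have -> : [set x : X | x \in Y] = closure (range q).
    by apply/seteqP; split=> x /asboolP.
  exact: closed_closure.
- have qY c : q c \in Y by exact/asboolP/q_closure.
  exists (range (fun c => NormedSubspace (qY c))); split.
    by apply: card_le_trans (card_image_le _ _) _; exact: countableP.
  apply/dense_norm => x e e0.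
  have /asboolP/closure_norm/(_ e e0)[_ [c _ <-] xc] := subspace_valP x.
  by exists (NormedSubspace (qY c)); first by exists c.
Qed.

(** Points of D within e / 2 of the [g S] are distinct for distinct S, so a countable dense D would
    inject the power set of nat into nat. *)
Lemma not_separable_of_separated (X : normedModType R) (g : set nat -> X)
    (e : R) :
  0 < e -> (forall S T, S <> T -> e <= `|g S - g T|) -> ~ separable X.
Proof.
move=> e0 ge [D [/countable_injP[h hinj] /dense_norm dD]].
have /choice[d dP] S : exists y, D y /\ `|g S - y| < e / 2.
  by have [y Dy gy] := dD (g S) (e / 2) ltac:(lra); exists y.
have dinj S T : h (d S) = h (d T) -> S = T.
  have [[DS gS] [DT gT]] := (dP S, dP T).
  move=> /hinj; rewrite !inE => /(_ DS DT) dST; apply: contrapT => /ge.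
  have := ler_normD (g S - d S) (d T - g T).
  rewrite -[X in _ + `|X|]opprB normrN.
  by rewrite dST addrA subrK; move: gS; rewrite dST; lra.
(* Cantor's diagonal set for the injection sending T to h (d T). *)
pose S := [set n | exists2 T, h (d T) = n & ~ T n].
have Sh : S (h (d S)) by apply: contrapT => nS; apply: (nS); exists S.
by have [T /dinj -> ] := Sh.
Qed.

End normed.

Section contraction_dual.
Context {R : realType}.

(** By linearity the bound makes g 1-Lipschitz, hence continuous. *)
Lemma contraction_dual (V : normedModType R) (g : V -> R^o) :
  linear g -> (forall x, `|g x| <= `|x|) -> exists G : dual V, G =1 g.
Proof.
move=> lg g1; suff cg : continuous g.
  have Fg : g \in @functional R V by exact/asboolP.
  by exists (Dual Fg).
move=> x; apply/cvgrPdist_lt => e e0; near=> y.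
have -> : g x - g y = g (x - y).
  by rewrite [x - y]addrC -[- y]scaleN1r lg scaleN1r addrC.
apply: le_lt_trans (g1 _) _; near: y; exact: cvgr_dist_lt.
Unshelve. all: by end_near. Qed.

End contraction_dual.

(** * Vertices of the graph indexed by sets of naturals *)

Definition posnatS (n : nat) : posnat := exist _ n.+1 (ltn0Sn n).

(* S and its complement choose opposite elements of each pair {2i+1, 2i+2},
   so the ranges of [select S] and [select (~` S)] are disjoint, and distinct S
   have incomparable ranges. *)
Definition select (S : set nat) (i : nat) : posnat :=
  posnatS (i.*2 + `[< S i >]).

Lemma select_disjoint (S : set nat) i j : select S i <> select (~` S) j.
Proof.
move=> /(congr1 val) /= [] ij.
(* Parity recovers the chosen bit; then i = j, and the truth value of S at this index would equal
   its own negation. *)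
have /= := congr1 odd ij; rewrite !oddD !odd_double !oddb /= => Sij.
move: ij; rewrite Sij => /addIn/double_inj ij; move: Sij; rewrite ij.
by rewrite asbool_neg; case: `[< _ >].
Qed.

Lemma selectC (S T : set nat) i :
  ~ (S i <-> T i) -> select S i = select (~` T) i.
Proof.
move=> ST; rewrite /select asbool_neg; congr (posnatS (_ + nat_of_bool _)).
by case: asboolP; case: asboolP => //; tauto.
Qed.

(** The indices run from 0 to k inclusive: the set is nonempty even for k = 0 and contains
    [select S i] whenever i <= k. *)
Definition selection (S : set nat) (k : nat) : {fset posnat} :=
  [fset select S i | i in iota 0 k.+1]%fset.

Lemma selection_neq0 S k : selection S k != fset0.
Proof. by apply/fset0Pn; exists (select S 0); apply: in_imfset. Qed.

Definition VSelection (S : set nat) (k : nat) : vertex :=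
  VFin (exist _ (selection S k) (selection_neq0 S k)).

Lemma path_dist_selectionC S k :
  path_dist (VSelection S k) (VSelection (~` S) k) = 4%N.
Proof.
have disj : (selection S k `&` selection (~` S) k = fset0)%fset.
  apply/eqP/fset0Pn => -[n]; rewrite inE => /andP[].
  move=> /imfsetP[i _ ->] /imfsetP[j _]; exact: select_disjoint.
(* [explicit_dist] tests equality before disjointness; two equal disjoint sets would be empty. *)
rewrite path_distE /= disj eqxx; case: eqP => // /(congr1 val) /= SS.
by move: disj; rewrite -SS fsetIid => /eqP;
  rewrite (negbTE (selection_neq0 S k)).
Qed.

Lemma path_dist_selection S i k : (i <= k)%N ->
  path_dist (VSelection S k) (VNat (select S i)) = 1%N.
Proof.
move=> ik; rewrite path_distE /= ifT//.
by apply: in_imfset; rewrite [_ \in _]mem_iota.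
Qed.

Lemma path_dist_VNat n m : (path_dist (VNat n) (VNat m) <= 2)%N.
Proof. by rewrite path_distE /=; case: ifP. Qed.

(** * The lower bound on the distortion *)

Section embedding.
Context {R : realType} (X : completeNormedModType R).

Lemma not_asplund_of_bilipschitz (f : graph_space R -> X) (C1 C2 : R) :
  bilipschitz_bounds f C1 C2 -> C2 < 2 * C1 -> ~ asplund X.
Proof.
move=> [C10 C20 fC] C21 aX.
have [Y [uY /aX sY /sY sdY]] :=
  separable_closed_subspace X (fun n => f (VNat (posnatS n))).
(* [v S k] joins images at distance 4, and [w S i] approximates it for all k >= i; only the vectors
   [w S i] are known to lie in Y. *)
pose v S k := f (VSelection S k) - f (VSelection (~` S) k).
pose w S i := f (VNat (select S i)) - f (VNat (select (~` S) i)).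
have v4 S k : 4 * C1 <= `|v S k|.
  have /andP[] := fC (VSelection S k) (VSelection (~` S) k).
  by rewrite mdist_graph_space path_dist_selectionC mulrC.
have wv S i k : (i <= k)%N -> `|w S i - v S k| <= 2 * C2.
  move=> ik.
  have d1 T : `|f (VSelection T k) - f (VNat (select T i))| <= C2.
    have /andP[_] := fC (VSelection T k) (VNat (select T i)).
    by rewrite mdist_graph_space path_dist_selection// mulr1.
  have -> : w S i - v S k =
      - (f (VSelection S k) - f (VNat (select S i))) +
      (f (VSelection (~` S) k) - f (VNat (select (~` S) i))).
    rewrite /w /v !opprB [RHS]addrC addrACA [RHS]addrACA; congr (_ + _).
    by rewrite addrC.
  rewrite (le_trans (ler_normD _ _))// normrN.
  by have := d1 S; have := d1 (~` S); lra.
have w2 S i : `|w S i| <= 2 * C2.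
  have /andP[_ /le_trans->//] :=
    fC (VNat (select S i)) (VNat (select (~` S) i)).
  rewrite mdist_graph_space mulrC ler_wpM2r ?(ltW C20)// ler_nat.
  exact: path_dist_VNat.
have wY S i : w S i \in Y.
  rewrite /w -[X in _ + X]scaleN1r addrC.
  by apply: (GRing.submodClosedP Y).2; exact: uY.
pose wS S i := NormedSubspace (wY S i).
have /choice[G GP] (S : set nat) : exists G : dual (normed_subspace Y),
    forall i, 4 * C1 - 2 * C2 <= G (wS S i).
  have [g [lg g1 gv]] :=
    eventually_close_functional X (v S) (4 * C1) (2 * C2) (v4 S).
  (* The functional is built on X, where the [v S k] live, and then restricted to Y. *)
  pose gY (y : normed_subspace Y) : R^o := g y.
  have lgY : linear gY by move=> a x y; exact: lg.
  have [G Gg] := contraction_dual _ _ lgY (fun y => g1 y).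
  by exists G => i; rewrite Gg; apply: (gv _ i) => k; exact: wv.
(* At some w of norm at most 2 * C2, G S - G T takes a value of at least 2 * (4 * C1 - 2 * C2); the
   separation constant is the quotient. *)
apply: (not_separable_of_separated _ G ((4 * C1 - 2 * C2) / C2) _ _ sdY).
  by rewrite divr_gt0//; lra.
move=> S T ST.
have [i STi] : exists i, ~ (S i <-> T i).
  apply/existsNP => ST_eq; apply: ST; apply/funext => i; exact/propext/ST_eq.
(* Where S and T differ, the two selected naturals are exchanged, so w changes sign and the two
   lower bounds add up. *)
have wN : wS T i = - wS S i.
  apply: val_inj => /=; rewrite /w opprB.
  by rewrite (selectC S T i STi) (selectC T S i)//; tauto.
have GN (H : dual (normed_subspace Y)) x : H (- x) = - H x.
  by rewrite -scaleN1r dual_scale mulN1r.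
have GST : (G S - G T) (wS S i) = G S (wS S i) + G T (wS T i) by rewrite wN GN.
have wSi : `|G S - G T| * `|wS S i| <= `|G S - G T| * (2 * C2).
  by rewrite ler_wpM2l//; exact: w2.
have := le_trans (le_dual_norm (G S - G T) (wS S i)) wSi; rewrite GST.
have := GP S i; have := GP T i; have := ler_norm (G S (wS S i) + G T (wS T i)).
by rewrite ler_pdivrMr//; lra.
Qed.

(** An infimum below 2 provides a single admissible pair of constants with ratio below 2;
    bi-Lipschitz continuity of f makes the set of ratios nonempty, so that [inf] is not a default
    value. *)
Lemma asplund_distortion_ge2 (D : R) :
  asplund X -> embeds_with_distortion (graph_space R) X D -> 2 <= D.
Proof.
move=> aX [f [[C1 [C2 fC]] <-]]; rewrite leNgt; apply/negP => /inf_lt[].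
  by exists (C2 / C1), C1, C2.
move=> _ [K1 [K2 [fK ->]]]; have [K10 _ _] := fK.
by rewrite ltr_pdivrMr// => K21; exact: not_asplund_of_bilipschitz fK K21 aX.
Qed.

End embedding.

Lemma separable_graph_space (R : realType) : separable (graph_space R).
Proof.
exists setT; split; first exact: countableP.
by move=> O O0 _; rewrite setIT.
Qed.

Theorem theorem4 (R : realType) :
  (forall (X : completeNormedModType R) (D : R),
     asplund X -> embeds_with_distortion (graph_space R) X D -> 2 <= D) /\
  ~ (exists X : completeNormedModType R,
       asplund X /\
       forall S : metricType R, separable S ->
         exists D : R, D < 2 /\ embeds_with_distortion S X D).
Proof.
split=> [X D|[X [aX /(_ (graph_space R) (separable_graph_space R))]]].
  exact: asplund_distortion_ge2.
by move=> [D [D2 /(asplund_distortion_ge2 _ _ aX)]]; rewrite leNgt D2.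
Qed.
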